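(* There is an algorithm that, for any stable matching instance with one-sided uncertainty and any given matching $M$, decides whether $M$ is stable and $B$-optimal using $\mathcal{O}(n \log n)$ set queries.
   Context: Two disjoint sets $A$, $B$ of agents with $|A|=|B|=n$. Each $a\in A$ has a strict total order $\prec_a$ on $B$ and each $b\in B$ has a strict total order $\prec_b$ on $A$ ($x\prec_y z$: $y$ prefers $x$ to $z$). A matching is a bijection between $A$ and $B$; it is stable if there is no pair $(a,b)$, $b\neq M(a)$, with $a$ preferring $b$ to $M(a)$ and $b$ preferring $a$ to $M(b)$. A stable matching is $B$-optimal if every agent of $B$ weakly prefers its partner in it to its partner in any other stable matching. One-sided uncertainty: the orders $\prec_a$ ($a\in A$) are known, the orders $\prec_b$ ($b\in B$) are unknown and learned only via queries. A set query $\mathit{top}(b,S)$ for $b\in B$ and $S\subseteq A$ returns $b$'s most preferred element of $S$. The algorithm queries adaptively and its answer must be correct for every $B$-side preference profile consistent with the $A$-side preferences and the answers received. *)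

(* Defs.v *)
From mathcomp Require Import all_boot.

Set Implicit Arguments.
Unset Strict Implicit.
Unset Printing Implicit Defensive.

(* For [r : pref T], [r x z] reads "x is strictly preferred to z". *)
Record pref (T : finType) := Pref {
  prefers :> rel T;
  pref_irr : irreflexive prefers;
  pref_trans : transitive prefers;
  pref_total : forall x y, x != y -> prefers x y || prefers y x
}.

(* A bijection given together with its inverse, so that both M(a) and M(b)
   can be written. *)
Record matching (A B : finType) := Matching {
  mateA : A -> B;
  mateB : B -> A;
  mateAK : cancel mateA mateB;
  mateBK : cancel mateB mateA
}.

Definition blocking (A B : finType) (PA : A -> pref B) (PB : B -> pref A)
    (M : matching A B) (a : A) (b : B) : Prop :=
  [/\ b != mateA M a, PA a b (mateA M a) & PB b a (mateB M b)].

Definition stable (A B : finType) (PA : A -> pref B) (PB : B -> pref A)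
    (M : matching A B) : Prop :=
  ~ exists a b, blocking PA PB M a b.

Definition B_optimal (A B : finType) (PA : A -> pref B) (PB : B -> pref A)
    (M : matching A B) : Prop :=
  stable PA PB M /\
  forall M' : matching A B, stable PA PB M' ->
  forall b, mateB M b = mateB M' b \/ PB b (mateB M b) (mateB M' b).

(* [top r S] is the most preferred element of [S]; it is [None] exactly when
   [S] is empty, so a query on the empty set reveals nothing. *)
Definition top (T : finType) (r : pref T) (S : {set T}) : option T :=
  [pick x in S | [forall y in S, (y != x) ==> r x y]].

(* Adaptive algorithms as decision trees: [Query b X k] asks top(b, X) and goes
   on with [k] applied to the answer. The B-side profile enters an execution
   only through these answers, so a tree outputs the same value on all the
   profiles consistent with the answers received. *)
Inductive query_alg (A B : finType) : Type :=
| Answer of bool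
| Query of B & {set A} & (option A -> query_alg A B).

Fixpoint output (A B : finType) (PB : B -> pref A) (t : query_alg A B) : bool :=
  match t with
  | Answer d => d
  | Query b X k => output PB (k (top (PB b) X))
  end.

Fixpoint num_queries (A B : finType) (PB : B -> pref A)
    (t : query_alg A B) : nat :=
  match t with
  | Answer _ => 0
  | Query b X k => (num_queries PB (k (top (PB b) X))).+1
  end.

(* Main.v *)
(** For a stable matching [M], say that [b] desires [a] if [b] prefers [a] to
    [M(b)], and let [s(a)] be the desirer of [a] that [a] likes best. Then [M] is
    [B]-optimal iff the partial map [a |-> M(s(a))] has no cycle: a cycle is a
    rotation whose elimination improves [B], and the agents of [A] that are worse
    off in a stable matching improving some [b] are closed under this map.
    All the [s(a)] are found by simultaneous binary searches. In a round, every
    [a] asks whether it has a desirer in the upper half of its interval of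
    candidates, and [b] is repeatedly queried on [M(b)] together with the pending
    [a] having [b] in their upper half. An answer [M(b)] settles all these pairs
    at once, and any other answer [a] settles the round of [a], so that a round
    takes at most [2n] queries. *)

Require Import Defs.
From mathcomp Require Import all_boot.

Set Implicit Arguments.
Unset Strict Implicit.
Unset Printing Implicit Defensive.

(** * Ranks in a strict total order and most preferred elements *)

Section Rank.
Variables (T : finType) (r : pref T).

Definition rank (x : T) : nat := #|[set y | r y x]|.

Lemma pref_asym x y : r x y -> ~~ r y x.
Proof.
by move=> rxy; apply/negP=> /(pref_trans rxy); rewrite pref_irr.
Qed.

Lemma ltn_rank x y : (rank x < rank y) = r x y.
Proof.
have rank_lt u v : r u v -> rank u < rank v.
  move=> ruv; apply/proper_card/properP; split.
    by apply/subsetP=> z; rewrite !inE => /pref_trans; apply.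
  by exists u; rewrite !inE ?pref_irr.
apply/idP/idP=> [lt_xy|]; last exact: rank_lt.
have [eq_xy|/(pref_total r)/orP[//|/rank_lt]] := eqVneq x y.
  by rewrite eq_xy ltnn in lt_xy.
by move/(ltn_trans lt_xy); rewrite ltnn.
Qed.

Lemma leq_rank x y : (rank x <= rank y) = ~~ r y x.
Proof. by rewrite leqNgt ltn_rank. Qed.

Lemma rank_inj : injective rank.
Proof.
move=> x y eq_xy; apply/eqP/negPn/negP=> /(pref_total r).
by rewrite -!ltn_rank eq_xy ltnn.
Qed.

Lemma rank_lt_card x : rank x < #|T|.
Proof.
rewrite -cardsT; apply/proper_card/properP; split; first exact: subsetT.
by exists x; rewrite !inE ?pref_irr.
Qed.

Lemma topP (S : {set T}) x0 : x0 \in S ->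
  exists x, [/\ top r S = Some x, x \in S & {in S, forall y, ~~ r y x}].
Proof.
move=> Sx0; have [x Sx min_x] := arg_minnP rank Sx0.
have beats y : y \in S -> y != x -> r x y.
  move=> Sy; rewrite eq_sym => /(pref_total r)/orP[//|].
  by rewrite -ltn_rank ltnNge min_x.
rewrite /top; case: pickP => [z /andP[Sz /forall_inP max_z]|/(_ x)]; last first.
  by case/andP; split=> //; apply/forall_inP=> y Sy; apply/implyP; apply: beats.
exists z; split=> // y Sy.
have [->|ne_yz] := eqVneq y z; first by rewrite pref_irr.
by apply: pref_asym; apply: (implyP (max_z y Sy)).
Qed.

End Rank.

(** * Rotations characterise [B]-optimality among stable matchings *)

Section Rotations.
Variables (A B : finType) (PA : A -> pref B) (PB : B -> pref A).
Variable M : matching A B.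

Definition desires (b : B) (a : A) : bool := PB b a (mateB M b).

(** The graph of [s], kept as a relation since [s] is undefined at an undesired [a]. *)
Definition best_desirer (a : A) (b : B) : bool :=
  desires b a && [forall b', desires b' a ==> (rank (PA a) b <= rank (PA a) b')].

(* Some nonempty set is closed under [a |-> M(s(a))] iff this map has a cycle. *)
Definition rotating (s : A -> pred B) (Z : {set A}) : bool :=
  (Z != set0) && [forall a in Z, [exists b, s a b && (mateB M b \in Z)]].

Lemma eq_rotating s s' : s =2 s' -> rotating s =1 rotating s'.
Proof.
move=> eq_s Z; congr (_ && _); apply: eq_forallb_in => a _.
by apply: eq_existsb => b; rewrite eq_s.
Qed.

Lemma best_desirer_exists a b : desires b a -> exists b', best_desirer a b'.
Proof.
move=> des_ba; have [b' des_b'a min_b'] :=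
  @arg_minnP _ b (desires^~ a) (rank (PA a)) des_ba.
by exists b'; rewrite /best_desirer des_b'a; apply/forall_inP.
Qed.

Lemma best_desirer_unique a b b' :
  best_desirer a b -> best_desirer a b' -> b = b'.
Proof.
move=> /andP[Db /forall_inP minb] /andP[Db' /forall_inP minb'].
by apply/(@rank_inj _ (PA a))/eqP; rewrite eqn_leq minb ?minb'.
Qed.

Lemma stableP (N : matching A B) :
  stable PA PB N <->
  forall a b, PA a b (mateA N a) -> ~~ PB b a (mateB N b).
Proof.
split=> [stN a b pa | stN [a [b [_ pa pb]]]]; last by have /negP := stN a b pa.
apply/negP=> pb; apply: stN; exists a, b; split=> //.
by apply: contraTneq pa => ->; rewrite pref_irr.
Qed.

Lemma matching_card : #|B| = #|A|.
Proof.
apply/esym/(bij_eq_card (f := mateA M)).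
by exists (mateB M); [apply: mateAK | apply: mateBK].
Qed.

Lemma matching_of_injective (f : A -> B) :
  injective f -> exists N : matching A B, mateA N = f.
Proof.
move=> injf; have [g fK gK] := inj_card_bij injf (eq_leq matching_card).
by exists (Matching fK gK).
Qed.

Hypothesis stM : stable PA PB M.

(** Stability of [M] and [N] makes [N] send [X] into [Z] and [M] send [Z] into [X]; by counting,
    both maps are onto. For [a] in [Z], the best desirer of [a] is [N(a)] or is liked better by [a]
    than [N(a)], so it lies in [X], as it would otherwise block [N] with [a]. *)
Lemma improving_rotating (N : matching A B) b0 :
  stable PA PB N -> PB b0 (mateB N b0) (mateB M b0) ->
  exists Z, rotating best_desirer Z.
Proof.
move=> /stableP stN pb0; have /stableP stM' := stM.
pose X := [set b | PB b (mateB N b) (mateB M b)].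
pose Z := [set a | PA a (mateA M a) (mateA N a)].
have NX_Z : mateB N @: X \subset Z.
  apply/subsetP=> _ /imsetP[b + ->]; rewrite !inE mateBK => pb.
  have := stM' (mateB N b) b; rewrite pb.
  have [eq_b|/(pref_total (PA (mateB N b)))/orP[//|-> /(_ isT)//]] :=
    eqVneq (mateA M (mateB N b)) b.
  by rewrite (canRL (mateAK M) eq_b) pref_irr in pb.
have MZ_X : mateA M @: Z \subset X.
  apply/subsetP=> _ /imsetP[a + ->]; rewrite !inE mateAK => pa.
  have := stN _ _ pa.
  have [eq_a|/(pref_total (PB (mateA M a)))/orP[//|-> //]] :=
    eqVneq (mateB N (mateA M a)) a.
  by rewrite (canRL (mateBK N) eq_a) pref_irr in pa.
have inj_MA := can_inj (mateAK M); have inj_NB := can_inj (mateBK N).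
have leXZ : #|X| <= #|Z| by rewrite -(card_imset _ inj_NB) subset_leq_card.
have eqMZ : mateA M @: Z = X.
  by apply/eqP; rewrite eqEcard MZ_X card_imset.
have eqNX : mateB N @: X = Z.
  by apply/eqP; rewrite eqEcard NX_Z card_imset // -(card_imset _ inj_MA)
    subset_leq_card.
exists Z; apply/andP; split.
  by apply/set0Pn; exists (mateB N b0); rewrite -eqNX imset_f // inE.
apply/forall_inP=> a; rewrite -{1}eqNX => /imsetP[b Xb ->].
have Db : desires b (mateB N b) by move: Xb; rewrite inE.
have [b' best_b'] := best_desirer_exists Db; apply/existsP; exists b'.
rewrite best_b' /=; have /andP[Db' /forall_inP/(_ b Db) le_b'] := best_b'.
suff: b' \in X by rewrite -eqMZ => /imsetP[a' Za' ->]; rewrite mateAK.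
have [->//|ne_b] := eqVneq b' b.
have pa : PA (mateB N b) b' (mateA N (mateB N b)).
  rewrite mateBK -ltn_rank ltn_neqAle le_b' andbT.
  by apply: contraNneq ne_b => /rank_inj->.
move: (stN _ _ pa) Db'; rewrite /desires inE.
have [<-//|/(pref_total (PB b'))/orP[|-> //]] :=
  eqVneq (mateB N b') (mateB N b).
by move=> /pref_trans trN _ /trN.
Qed.

Lemma rotating_not_optimal Z0 :
  rotating best_desirer Z0 -> ~ B_optimal PA PB M.
Proof.
move=> /minset_exists[Z /minsetP[/andP[Z_n0 /forall_inP closed_Z] min_Z] _].
move=> [_ optM]; have /stableP stM' := stM.
(* On [Z], the only place where [s] is used, the default is never taken. *)
pose s a := odflt (mateA M a) [pick b | best_desirer a b].
have sP a : a \in Z -> best_desirer a (s a) && (mateB M (s a) \in Z).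
  move=> /closed_Z/existsP[b /andP[best_b Zb]]; rewrite /s.
  case: pickP => [b' best_b'|/(_ b)]; last by rewrite best_b.
  by rewrite best_b' (best_desirer_unique best_b' best_b).
(* On a minimal rotating set the map [a |-> M(s(a))] is a permutation. *)
have fZ : [set mateB M (s a) | a in Z] = Z.
  apply: min_Z; last by apply/subsetP=> _ /imsetP[a /sP/andP[_ Za] ->].
  apply/andP; split.
    by have /set0Pn[a Za] := Z_n0; apply/set0Pn; exists (mateB M (s a));
      apply: imset_f.
  apply/forall_inP=> _ /imsetP[a Za ->]; have /andP[_ Za'] := sP a Za.
  apply/existsP; exists (s (mateB M (s a))).
  by have /andP[-> _] := sP _ Za'; apply: imset_f.
have inj_sZ : {in Z &, injective s}.
  have /imset_injP inj_f : #|[set mateB M (s a) | a in Z]| == #|Z| by rewrite fZ.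
  by move=> a a' Za Za' eq_s; apply: inj_f; rewrite ?eq_s.
have MsZ a : a \in Z -> mateB M (s a) \in Z by case/sP/andP.
have [|N NE] :=
    @matching_of_injective (fun a => if a \in Z then s a else mateA M a).
  move=> a a' /=; case: ifP => Za; case: ifP => Za'; first exact: inj_sZ.
  - by move=> eq_s; move: (MsZ a Za); rewrite eq_s mateAK Za'.
  - by move=> eq_s; move: (MsZ a' Za'); rewrite -eq_s mateAK Za.
  - exact: can_inj (mateAK M) _ _.
have NB b : mateB N b = mateB M b \/ desires b (mateB N b).
  have := mateBK N b; rewrite {1}NE.
  case: ifP => [/sP/andP[/andP[D _] _] eq_b|_ eq_b].
    by right; rewrite -{1}eq_b.
  by left; rewrite -{2}eq_b mateAK.
(* Every [b] weakly gains from [M] to [N], so in a pair blocking [N], [b] already desires [a]. If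
   [a] is in [Z], it holds its best desirer; otherwise it keeps [M(a)] and the pair blocks [M]. *)
have stN : stable PA PB N.
  apply/stableP=> a b pa; apply/negP=> pb.
  have Db : desires b a.
    by case: (NB b) pb => [-> // | D /pref_trans]; apply.
  move: pa; rewrite NE.
  case: ifP => [/sP/andP[/andP[_ /forall_inP/(_ b Db) le_b] _]|_].
    by apply/negP; rewrite -leq_rank.
  by move/stM'; rewrite -/(desires b a) Db.
have /set0Pn[a Za] := Z_n0.
have /andP[/andP[Da _] _] := sP a Za.
have := optM N stN (s a).
have ->: mateB N (s a) = a by rewrite -[RHS](mateAK N) NE Za.
move: Da; rewrite /desires => Da [eq_a|]; last by apply/negP/pref_asym.
by rewrite eq_a pref_irr in Da.
Qed.

Lemma B_optimalP :
  B_optimal PA PB M <-> ~~ [exists Z, rotating best_desirer Z].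
Proof.
split=> [opt|noZ]; first by apply/existsP=> -[Z /rotating_not_optimal].
split=> // N stN b; have [|/(pref_total (PB b))/orP[]] :=
  eqVneq (mateB M b) (mateB N b); [by left | by right |].
move=> /(improving_rotating stN)[Z rotZ].
by case/existsP: noZ; exists Z.
Qed.

End Rotations.

(** * Simultaneous binary search with set queries *)

Section Algorithm.
Variables (A B : finType) (PA : A -> pref B) (M : matching A B).

(* The pairs to be tested are the [(a, b)] with [a \in W b], and [act] loses the
   agents found to be desired in one of them. Every query shortens [bs] or [act],
   so that [size bs + #|act|] is enough fuel. *)
Fixpoint scan (fuel : nat) (bs : seq B) (W : B -> {set A}) (act : {set A})
    (k : {set A} -> query_alg A B) : query_alg A B :=
  match fuel, bs with
  | fuel'.+1, b :: bs' =>
      Query b (mateB M b |: act :&: W b) (fun ans =>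
        if ans is Some a then
          if a == mateB M b then scan fuel' bs' W act k
          else scan fuel' bs W (act :\ a) k
        else k act)
  | _, _ => k act
  end.

(** The candidates of [a] have ranks from [lo a] to [lo a + 2 ^ j - 1], and the better half is
    tested. The agents left in [act] have no desirer there, so their lower end moves up. *)
Fixpoint search (j : nat) (lo : A -> nat) (k : (A -> nat) -> query_alg A B) :
    query_alg A B :=
  if j is j'.+1 then
    scan (#|B| + #|A|) (enum B)
      (fun b => [set a | lo a <= rank (PA a) b < lo a + 2 ^ j']) [set: A]
      (fun act =>
         search j' (fun a => if a \in act then lo a + 2 ^ j' else lo a) k)
  else k lo.

(** The first scan tests stability: a desired pair in it is a blocking pair. *)
Definition verify : query_alg A B :=
  scan (#|B| + #|A|) (enum B) (fun b => [set a | PA a b (mateA M a)]) [set: A]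
    (fun act =>
       if act == [set: A] then
         search (trunc_log 2 #|A|).+1 (fun=> 0) (fun lo =>
           Answer A B
             (~~ [exists Z, rotating M (fun a b => rank (PA a) b == lo a) Z]))
       else Answer A B false).

Variable PB : B -> pref A.
Local Notation desires := (desires PB M).

Definition desired_in (bs : seq B) (W : B -> {set A}) : {set A} :=
  [set a | has (fun b => (a \in W b) && desires b a) bs].

Lemma output_scan fuel bs W (act : {set A}) k : size bs + #|act| <= fuel ->
  output PB (scan fuel bs W act k) = output PB (k (act :\: desired_in bs W)).
Proof.
have nil_in : desired_in [::] W = set0 by apply/setP=> a; rewrite !inE.
elim: fuel bs act => [|fuel IH] [|b bs] act //=.
- by rewrite nil_in setD0.
- by rewrite nil_in setD0.
rewrite addSn ltnS => le_fuel.
(* The queried set contains [M(b)], so the answer is never [None]. *)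
have [a [-> Sa min_a]] := topP (PB b) (setU11 (mateB M b) (act :&: W b)).
case: eqVneq => [eq_a|ne_a].
  rewrite IH //; congr (output PB (k _)); apply/setP=> a'; rewrite !inE /=.
  rewrite negb_or; case: (boolP (a' \in act)) => act_a'; rewrite ?andbF //.
  case: (boolP (a' \in W b)) => //= Wa'.
  by rewrite /desires -eq_a min_a // !inE act_a' Wa' orbT.
move: (Sa); rewrite !inE (negbTE ne_a) => /andP[act_a Wa].
have Da : desires b a.
  by have := pref_total (PB b) ne_a; rewrite (negbTE (min_a _ (setU11 _ _))) orbF.
have le_fuel' : size (b :: bs) + #|act :\ a| <= fuel.
  by move: le_fuel; rewrite (cardsD1 a) act_a add1n addnS.
rewrite IH //=.
congr (output PB (k _)); apply/setP=> a'; rewrite !inE /=.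
by case: eqVneq => [->|]; rewrite // Wa Da.
Qed.

Lemma num_queries_scan fuel bs W act k c :
  (forall act', num_queries PB (k act') <= c) ->
  num_queries PB (scan fuel bs W act k) <= fuel + c.
Proof.
move=> le_k; elim: fuel bs act => [|fuel IH] [|b bs] act //=.
  by apply: leq_trans (le_k _) (leq_addl _ _).
rewrite addSn ltnS.
case: top => [a|]; last exact: leq_trans (le_k _) (leq_addl _ _).
by case: ifP => _; apply: IH.
Qed.

Lemma num_queries_search j lo k c :
  (forall lo', num_queries PB (k lo') <= c) ->
  num_queries PB (search j lo k) <= j * (#|B| + #|A|) + c.
Proof.
move=> le_k; elim: j lo => [|j IH] lo //=.
by rewrite mulSn -addnA; apply: num_queries_scan => act; apply: IH.
Qed.

(** One scan for stability and [(trunc_log 2 #|A|).+1] search rounds, each bounded by its fuel. *)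
Lemma num_queries_verify :
  num_queries PB verify <= (trunc_log 2 #|A|).+2 * (#|B| + #|A|).
Proof.
rewrite /verify mulSn; apply: num_queries_scan => act; case: ifP => // _.
by rewrite -[leqRHS]addn0; apply: num_queries_search.
Qed.

(* The second alternative says that no test on [a] has succeeded so far. *)
Definition bracket (K j : nat) (lo : A -> nat) : Prop :=
  forall a, (forall b, desires b a -> lo a <= rank (PA a) b) /\
    ((exists2 b, desires b a & rank (PA a) b < lo a + 2 ^ j) \/
     lo a + 2 ^ j = 2 ^ K).

Lemma output_search K j lo k : bracket K j lo ->
  exists2 lo', bracket K 0 lo' &
    output PB (search j lo k) = output PB (k lo').
Proof.
elim: j lo => [|j IH] lo br_lo /=; first by exists lo.
rewrite output_scan -?cardE ?cardsT //; apply: IH => a.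
rewrite !inE andbT; have [le_lo hi] := br_lo a.
case: hasP => [[b _ /andP[]]|none] /=.
  by rewrite inE => /andP[_ lt_b] Db; split=> //; left; exists b.
have le_lo' b : desires b a -> lo a + 2 ^ j <= rank (PA a) b.
  move=> Db; rewrite leqNgt; apply/negP=> lt_b; case: none.
  by exists b; rewrite ?mem_enum // inE le_lo // lt_b.
by split=> //; rewrite -addnA addnn -mul2n -expnS.
Qed.

(** If no test on [a] succeeded, [lo a] is [2 ^ K - 1]. The strict bound on [#|B|] makes this too
    large to be a rank, so [a] has no desirer and no [b] is selected. *)
Lemma bracket0_best_desirer K lo : #|B| < 2 ^ K -> bracket K 0 lo ->
  forall a b, (rank (PA a) b == lo a) = best_desirer PA PB M a b.
Proof.
move=> lt_K br_lo a b; have [le_lo hi] := br_lo a.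
rewrite /best_desirer; apply/eqP/andP=> [eq_b|[Db /forall_inP min_b]].
  case: hi => [[b' Db']|]; rewrite expn0 addn1; last first.
    move=> eqK; move: lt_K; rewrite -eqK -eq_b ltnS leqNgt.
    by rewrite rank_lt_card.
  rewrite ltnS => le_b'; have <-: b' = b.
    apply: (@rank_inj _ (PA a)); apply/eqP.
    by rewrite eq_b eqn_leq le_b' le_lo.
  by split=> //; apply/forall_inP=> c Dc; apply: leq_trans le_b' (le_lo c Dc).
apply/eqP; rewrite eqn_leq le_lo // andbT.
case: hi => [[b' Db']|]; rewrite expn0 addn1.
  by rewrite ltnS; apply: leq_trans (min_b b' Db').
move=> eqK; apply: ltnW; apply: leq_trans (rank_lt_card _ _) _.
by rewrite -ltnS eqK.
Qed.

Lemma output_verify : output PB verify = true <-> B_optimal PA PB M.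
Proof.
rewrite /verify output_scan -?cardE ?cardsT //; case: ifP => [/eqP noD|someD].
  have stM : stable PA PB M.
    apply/stableP=> a b pa; apply/negP=> Db.
    have: a \in [set: A] by rewrite inE.
    rewrite -noD !inE andbT => /hasPn/(_ b); rewrite mem_enum inE => /(_ isT).
    by rewrite pa /desires Db.
  have [|lo br_lo ->/=] := @output_search (trunc_log 2 #|A|).+1
      (trunc_log 2 #|A|).+1 (fun=> 0)
      (fun lo => Answer A B
         (~~ [exists Z, rotating M (fun a b => rank (PA a) b == lo a) Z])).
    by move=> a; split=> //; right.
  have best_lo : forall a b, (rank (PA a) b == lo a) = best_desirer PA PB M a b.
    apply: bracket0_best_desirer br_lo.
    by rewrite (matching_card M) trunc_log_ltn.
  rewrite (eq_existsb (eq_rotating M best_lo)); by have [] := B_optimalP stM.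
split=> [//|[/stableP stM _]]; case/eqP: someD; apply/setP=> a.
rewrite !inE andbT.
by apply/hasPn=> b _ /=; rewrite inE; apply/negP=> /andP[/stM/negP].
Qed.

End Algorithm.

Theorem theorem24 :
  exists alg : forall A B : finType,
      (A -> pref B) -> matching A B -> query_alg A B,
    (forall (n : nat) (A B : finType), #|A| = n -> #|B| = n ->
     forall (PA : A -> pref B) (M : matching A B) (PB : B -> pref A),
       output PB (alg A B PA M) = true <->
       stable PA PB M /\ B_optimal PA PB M) /\
    (exists C n0 : nat,
     forall n : nat, n0 <= n ->
     forall A B : finType, #|A| = n -> #|B| = n ->
     forall (PA : A -> pref B) (M : matching A B) (PB : B -> pref A),
       num_queries PB (alg A B PA M) <= C * (n * trunc_log 2 n)).
Proof.
exists verify; split=> [n A B _ _ PA M PB|].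
  apply: iff_trans (output_verify PA M PB) _; split=> [opt|[]//].
  by split=> //; case: opt.
(* With [L = trunc_log 2 n], the bound is [(L + 2) * 2n]; [n >= 2] gives [L >= 1], hence
   [L + 2 <= 3 * L]. *)
exists 6, 2 => n n_ge2 A B cardA cardB PA M PB.
have := num_queries_verify PA M PB; rewrite cardA cardB => /leq_trans-> //.
have: 0 < trunc_log 2 n by rewrite trunc_log_gt0.
case: (trunc_log 2 n) => // L _.
rewrite addnn -mul2n -[6]/(3 * 2) (mulnC n) mulnACA leq_mul2r mulnS.
by rewrite -[L.+3]/(3 + L) leq_add2l leq_pmull ?orbT.
Qed.
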